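(* Let $(M^3,g)$ be a 3-dimensional pseudo-Riemannian manifold with Lorentzian metric $g$, and let $\alpha: I\subset\mathbb{R}\to M^3$ be a null curve with Frenet frame $\{V_1,V_2,V_3\}$ and nowhere zero curvatures $\kappa,\tau$. Let $f:M^3\to\mathbb{R}$ be a smooth function which is eikonal along $\alpha$ and whose Hessian satisfies $H^f=0$. If $\alpha$ is a null $f$-eikonal helix curve in $M^3$, then: (i) the function $\dfrac{\kappa}{\tau}$ is constant; (ii) the axis of the null $f$-eikonal helix curve is $$\nabla f=c\left(\frac{-\tau}{\kappa}V_1+V_2\right)$$ along $\alpha$, where $g(\nabla f,V_1)=c$ is a non-zero constant.
   Context: $\nabla$ denotes the Levi-Civita connection of $(M^3,g)$. A curve $\alpha(s)$ is null if $g(\alpha',\alpha')=0$. A Cartan (Frenet) frame of a null curve $\alpha$ is a family of vector fields $V_1,V_2,V_3$ along $\alpha$ with $V_1=\alpha'$, $g(V_1,V_1)=g(V_2,V_2)=0$, $g(V_1,V_2)=1$, $g(V_1,V_3)=g(V_2,V_3)=0$, $g(V_3,V_3)=1$, satisfying $$\nabla_{V_1}V_1=\kappa V_3,\quad \nabla_{V_1}V_2=\tau V_3,\quad \nabla_{V_1}V_3=-\tau V_1-\kappa V_2,$$ where $\kappa$ and $\tau$ are called the curvature and torsion. For $f:M^3\to\mathbb{R}$ smooth, $\nabla f$ is the gradient, $g(\nabla f,X)=X(f)$, and the Hessian is $H^f(X,Y)=g(\nabla_X(\nabla f),Y)$. The function $f$ is eikonal along $\alpha$ if $\|\nabla f\|=\sqrt{|g(\nabla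 f,\nabla f)|}$ is constant along $\alpha$. If $f$ is eikonal along the null curve $\alpha$, then $\alpha$ is a null $f$-eikonal helix curve if $g(\nabla f,V_1)$ is a non-zero constant along $\alpha$; in that case $\nabla f$ is called its axis. *)

(* Defs.v *)
From HB Require Import structures.
From mathcomp Require Import all_boot all_order all_algebra.
From mathcomp Require Import all_classical all_reals all_analysis.

Set Implicit Arguments.
Unset Strict Implicit.
Unset Printing Implicit Defensive.

Import Order.TTheory GRing.Theory Num.Theory.
Import numFieldNormedType.Exports.

Local Open Scope classical_set_scope.
Local Open Scope ring_scope.

(* C^k and C^oo functions on a set U, which is meant to be open. *)
Fixpoint Ck (R : realType) (V W : normedModType R) (k : nat) (U : set V)
    (f : V -> W) : Prop :=
  match k with
  | 0 => forall x, U x -> {for x, continuous f}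
  | k'.+1 => (forall x, U x -> differentiable f x) /\
             (forall v, Ck k' U (fun x => 'D_v f x))
  end.

Definition smooth_on (R : realType) (V W : normedModType R) (U : set V)
    (f : V -> W) : Prop := forall k, Ck k U f.

Definition smooth_near (R : realType) (V W : normedModType R) (f : V -> W)
    (x : V) : Prop := exists U : set V, [/\ open U, U x & smooth_on U f].

(* A chart is a homeomorphism chart_map from the open set chart_dom onto an
   open subset of R^n. As functions are total, chart_map outside chart_dom and
   chart_inv outside chart_map @` chart_dom carry no information. *)
Record chart (R : realType) (M : topologicalType) (n : nat) := Chart {
  chart_dom : set M;
  chart_map : M -> 'rV[R]_n;
  chart_inv : 'rV[R]_n -> M;
  chart_dom_open : open chart_dom;
  chart_img_open : open (chart_map @` chart_dom);
  chart_mapK : forall p, chart_dom p -> chart_inv (chart_map p) = p;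
  chart_map_continuous :
    forall p, chart_dom p -> {for p, continuous chart_map};
  chart_inv_continuous :
    forall p, chart_dom p -> {for chart_map p, continuous chart_inv} }.

(* The atlas comes with a choice chart_at p of a preferred chart around each
   point p. This choice is auxiliary: it only serves to represent tangent
   vectors, and the notions below do not depend on it. *)
Record manifold (R : realType) (n : nat) := Manifold {
  carrier :> topologicalType;
  hausdorff_carrier : hausdorff_space carrier;
  second_countable_carrier : @second_countable carrier;
  atlas : set (chart R carrier n);
  chart_at : carrier -> chart R carrier n;
  chart_at_atlas : forall p, atlas (chart_at p);
  chart_at_dom : forall p, chart_dom (chart_at p) p;
  atlas_compatible : forall phi psi, atlas phi -> atlas psi ->
    smooth_on (chart_map phi @` (chart_dom phi `&` chart_dom psi))
              (chart_map psi \o chart_inv phi) }.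

(* The tangent space at p is identified with R^n by taking components in the
   preferred chart at p; hence its type depends on p only formally, and vectors
   at distinct points are comparable only through components below. *)
Definition tangent (R : realType) (n : nat) (M : manifold R n) (p : M) : Type :=
  'rV[R]_n.

Definition vfield (R : realType) (n : nat) (M : manifold R n) : Type :=
  forall p : M, tangent p.

(* Components of a tangent vector v at p in a chart phi around p: v is mapped
   by the differential of the change of charts. *)
Definition components (R : realType) (n : nat) (M : manifold R n)
    (phi : chart R M n) (p : M) (v : tangent p) : 'rV[R]_n :=
  'D_v (chart_map phi \o chart_inv (chart_at p)) (chart_map (chart_at p) p).

(* The coordinate vector field d/dx^j of the chart phi, meaningful on
   chart_dom phi. *)
Definition chart_basis (R : realType) (n : nat) (M : manifold R n)
    (phi : chart R M n) (j : 'I_n) : vfield M :=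
  fun p => 'D_(delta_mx 0 j) (chart_map (chart_at p) \o chart_inv phi)
             (chart_map phi p).

(* v(h), the derivative of a function h along a tangent vector v at p. *)
Definition vderive (R : realType) (n : nat) (M : manifold R n) (p : M)
    (v : tangent p) (h : M -> R) : R :=
  'D_v (h \o chart_inv (chart_at p)) (chart_map (chart_at p) p).

Definition fun_smooth_at (R : realType) (n : nat) (M : manifold R n)
    (h : M -> R) (p : M) : Prop :=
  smooth_near (h \o chart_inv (chart_at p)) (chart_map (chart_at p) p).

Definition vfield_smooth_at (R : realType) (n : nat) (M : manifold R n)
    (X : vfield M) (p : M) : Prop :=
  smooth_near
    (fun x => components (chart_at p) (X (chart_inv (chart_at p) x)))
    (chart_map (chart_at p) p).

Record pseudo_metric (R : realType) (n : nat) (M : manifold R n) :=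
  PseudoMetric {
  metric :> forall p : M, tangent p -> tangent p -> R;
  metric_linear : forall (p : M) (a : R) (u v w : tangent p),
    @metric p (a *: u + v) w = a * @metric p u w + @metric p v w;
  metric_sym : forall (p : M) (u v : tangent p), @metric p u v = @metric p v u;
  metric_nondegenerate : forall (p : M) (u : tangent p),
    (forall v : tangent p, metric u v = 0) -> u = 0;
  metric_smooth : forall (X Y : vfield M) (p : M),
    vfield_smooth_at X p -> vfield_smooth_at Y p ->
    fun_smooth_at (fun q => @metric q (X q) (Y q)) p }.

(* Signature (-, +, ..., +). *)
Definition lorentzian (R : realType) (n : nat) (M : manifold R n)
    (g : pseudo_metric M) : Prop :=
  forall p : M, exists E : 'I_n -> tangent p, forall i j : 'I_n,
    g p (E i) (E j) =
    if i == j then (if (i : nat) == 0%N then -1 else 1) else 0.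

(* nabla v Y is the covariant derivative at p of Y along v : tangent p. The
   axioms are stated for vector fields smooth near p (and arbitrary elsewhere),
   so that locally defined fields, extended by arbitrary values, are allowed;
   the Leibniz rule makes nabla v Y depend only on Y near p. *)
Record connection (R : realType) (n : nat) (M : manifold R n) := Connection {
  nabla :> forall p : M, tangent p -> vfield M -> tangent p;
  nabla_linear : forall (p : M) (a : R) (u v : tangent p) (Y : vfield M),
    vfield_smooth_at Y p ->
    @nabla p (a *: u + v) Y = a *: @nabla p u Y + @nabla p v Y;
  nabla_add : forall (p : M) (v : tangent p) (Y Z : vfield M),
    vfield_smooth_at Y p -> vfield_smooth_at Z p ->
    @nabla p v (fun q => Y q + Z q) = @nabla p v Y + @nabla p v Z;
  nabla_leibniz : forall (p : M) (v : tangent p) (h : M -> R) (Y : vfield M),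
    fun_smooth_at h p -> vfield_smooth_at Y p ->
    @nabla p v (fun q => h q *: Y q)
    = vderive v h *: Y p + h p *: @nabla p v Y;
  nabla_smooth : forall (X Y : vfield M) (p : M),
    vfield_smooth_at X p -> vfield_smooth_at Y p ->
    vfield_smooth_at (fun q => @nabla q (X q) Y) p }.

(* nabla_X Y - nabla_Y X = [X, Y], with [X, Y] h = X (Y h) - Y (X h). *)
Definition torsion_free (R : realType) (n : nat) (M : manifold R n)
    (D : connection M) : Prop :=
  forall (p : M) (X Y : vfield M) (h : M -> R),
    vfield_smooth_at X p -> vfield_smooth_at Y p -> fun_smooth_at h p ->
    vderive (D p (X p) Y - D p (Y p) X : tangent p) h =
    vderive (X p) (fun q => vderive (Y q) h) -
    vderive (Y p) (fun q => vderive (X q) h).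

Definition metric_compatible (R : realType) (n : nat) (M : manifold R n)
    (g : pseudo_metric M) (D : connection M) : Prop :=
  forall (p : M) (v : tangent p) (Y Z : vfield M),
    vfield_smooth_at Y p -> vfield_smooth_at Z p ->
    vderive v (fun q => g q (Y q) (Z q)) =
    g p (D p v Y) (Z p) + g p (Y p) (D p v Z).

Definition levi_civita (R : realType) (n : nat) (M : manifold R n)
    (g : pseudo_metric M) (D : connection M) : Prop :=
  torsion_free D /\ metric_compatible g D.

(* The vector w with g(w, v) = v(f) for all v; it exists and is unique because
   g is nondegenerate. *)
Definition gradient (R : realType) (n : nat) (M : manifold R n)
    (g : pseudo_metric M) (f : M -> R) : vfield M :=
  fun p => xget (0 : 'rV[R]_n)
             [set w | forall v : tangent p, g p w v = vderive v f].

Definition hessian (R : realType) (n : nat) (M : manifold R n)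
    (g : pseudo_metric M) (D : connection M) (f : M -> R) (p : M)
    (u v : tangent p) : R :=
  g p (D p u (gradient g f)) v.

(* Curves are total functions on R, considered only on an open interval I. *)
Definition smooth_curve (R : realType) (n : nat) (M : manifold R n)
    (I : set R) (alpha : R -> M) : Prop :=
  forall s, I s -> {for s, continuous alpha} /\
    smooth_near (chart_map (chart_at (alpha s)) \o alpha : R^o -> 'rV[R]_n) s.

Definition velocity (R : realType) (n : nat) (M : manifold R n)
    (alpha : R -> M) (s : R) : tangent (alpha s) :=
  derive1 (chart_map (chart_at (alpha s)) \o alpha) s.

Definition vfield_along (R : realType) (n : nat) (M : manifold R n)
    (alpha : R -> M) : Type := forall s : R, tangent (alpha s).

Definition smooth_along (R : realType) (n : nat) (M : manifold R n)
    (I : set R) (alpha : R -> M) (V : vfield_along alpha) : Prop :=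
  forall s, I s ->
    smooth_near
      ((fun t => components (chart_at (alpha s)) (V t)) : R^o -> 'rV[R]_n) s.

(* The covariant derivative along alpha induced by D, at the parameter s:
   writing V = \sum_j a_j d/dx^j in the chart around alpha s,
   it is \sum_j (a_j' d/dx^j + a_j D_(alpha') d/dx^j). *)
Definition cov_along (R : realType) (n : nat) (M : manifold R n)
    (D : connection M) (alpha : R -> M) (V : vfield_along alpha) :
    vfield_along alpha :=
  fun s =>
    let phi := chart_at (alpha s) in
    let a (j : 'I_n) (t : R) : R := components phi (V t) 0 j in
    \sum_(j < n) (derive1 (a j) s *: chart_basis phi j (alpha s) +
                  a j s *: D (alpha s) (velocity alpha s) (chart_basis phi j)).

Definition null_curve (R : realType) (n : nat) (M : manifold R n)
    (g : pseudo_metric M) (I : set R) (alpha : R -> M) : Prop :=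
  smooth_curve I alpha /\
  forall s, I s -> g (alpha s) (velocity alpha s) (velocity alpha s) = 0.

Record cartan_frame (R : realType) (M : manifold R 3) (g : pseudo_metric M)
    (D : connection M) (I : set R) (alpha : R -> M)
    (V1 V2 V3 : vfield_along alpha) (kappa tau : R -> R) : Prop := CartanFrame {
  frame_smooth1 : smooth_along I V1;
  frame_smooth2 : smooth_along I V2;
  frame_smooth3 : smooth_along I V3;
  frame_tangent : forall s, I s -> V1 s = velocity alpha s;
  frame_g11 : forall s, I s -> g (alpha s) (V1 s) (V1 s) = 0;
  frame_g22 : forall s, I s -> g (alpha s) (V2 s) (V2 s) = 0;
  frame_g12 : forall s, I s -> g (alpha s) (V1 s) (V2 s) = 1;
  frame_g13 : forall s, I s -> g (alpha s) (V1 s) (V3 s) = 0;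
  frame_g23 : forall s, I s -> g (alpha s) (V2 s) (V3 s) = 0;
  frame_g33 : forall s, I s -> g (alpha s) (V3 s) (V3 s) = 1;
  frame_cov1 : forall s, I s -> cov_along D V1 s = kappa s *: V3 s;
  frame_cov2 : forall s, I s -> cov_along D V2 s = tau s *: V3 s;
  frame_cov3 : forall s, I s ->
    cov_along D V3 s = - tau s *: V1 s - kappa s *: V2 s }.

Definition eikonal_along (R : realType) (n : nat) (M : manifold R n)
    (g : pseudo_metric M) (I : set R) (alpha : R -> M) (f : M -> R) : Prop :=
  exists r : R, forall s, I s ->
    Num.sqrt `|g (alpha s) (gradient g f (alpha s)) (gradient g f (alpha s))|
    = r.

Definition null_eikonal_helix (R : realType) (n : nat) (M : manifold R n)
    (g : pseudo_metric M) (I : set R) (alpha : R -> M) (f : M -> R) : Prop :=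
  [/\ null_curve g I alpha, eikonal_along g I alpha f &
    exists2 c : R, c != 0 & forall s, I s ->
      g (alpha s) (gradient g f (alpha s)) (velocity alpha s) = c].

(* Main.v *)
From HB Require Import structures.
Require Import Defs.
From mathcomp Require Import all_boot all_order all_algebra.
From mathcomp Require Import all_classical all_reals all_analysis.
Import Order.TTheory GRing.Theory Num.Theory.
Import numFieldNormedType.Exports.
Local Open Scope classical_set_scope.
Local Open Scope ring_scope.

Set Implicit Arguments.
Unset Strict Implicit.
Unset Printing Implicit Defensive.

(** The vanishing of the Hessian says that [gradient g f] is parallel: by
    nondegeneracy of the metric, [D p u (gradient g f) = 0] for every [u].
    Hence, for a field [V] along the curve, the derivative of
    [g (gradient g f) V] is [g (gradient g f) (cov_along D V)].  Write [x1], [x2],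
    [x3] for the products of the gradient with the frame.  The helix condition
    makes [x1] a constant [c], and the three Frenet equations become
      [0 = x1' = kappa x3],  [0 = x3' = - tau c - kappa x2],
      [x2' = tau x3 = 0].
    The first gives [x3 = 0], the second [x2 = - tau c / kappa], and the third
    says that [x2] is constant; it is nonzero, so [kappa / tau = - c / x2] is constant
    too.  Finally a vector
    is determined by its products with a null frame, and the gradient
    has the same products as [c (- tau / kappa V1 + V2)].

    What needs work is the product rule [is_derive_metric_along], because
    tangent vectors at nearby points are related only through charts.  Near
    [alpha s] the field [V] is expanded in the coordinate fields of one chart
    [phi] ([sum_components]); each coefficient [g (gradient g f) (d/dx^j)] is then
    a smooth function on the manifold, to which metric compatibility applies.
    This requires the gradient to be a smooth field ([gradient_smooth]): in
    [phi] its components are the partial derivatives of [f] times the inverse of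
    the Gram matrix of the metric, and smooth functions are closed under the
    operations of Cramer's formula. *)

(** * Functions of class C^k on open sets of a normed module *)

(** Differentiability at a point only depends on the germ: [h] has at [x] the
    first-order expansion of [f], and the differential is determined by it. *)
Lemma near_eq_differentiable (R : numFieldType) (V W : normedModType R)
    (f h : V -> W) (x : V) :
  (\near x, f x = h x) -> differentiable f x -> differentiable h x.
Proof.
move=> fh df.
have fh0 : \forall k \near (0 : V), f (k + x) = h (k + x).
  by have := fh; rewrite (near_shift 0 x); apply: filterS => k; rewrite /= subr0.
have hE : h \o shift x = cst (h x) + ('d f x : V -> W) +o_ 0 id.
  have [_ fE] := (diff_locallyP x f).1 df.
  apply/eqaddoP => _ /posnumP[e]; near=> k.
  have -> : (h \o shift x - (cst (h x) + ('d f x : V -> W))) k =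
            (f \o shift x - (cst (f x) + ('d f x : V -> W))) k.
    rewrite !fctE /= -(nbhs_singleton fh); congr (_ - _).
    by apply/esym; near: k.
  by near: k; move/eqaddoP : fE; apply.
have dhE := diff_unique (diff_continuous df) hE.
by apply/diff_locallyP; rewrite dhE; split => //; exact: diff_continuous.
Unshelve. all: by end_near. Qed.

Section Ck_calculus.
Context {R : realType} {V : normedModType R}.
Implicit Types (W : normedModType R) (U : set V).

(** Unfolds one level of [Ck] without exposing its fixpoint. *)
Lemma CkS W k U (f : V -> W) : Ck k.+1 U f <->
  (forall x, U x -> differentiable f x) /\ forall v, Ck k U (fun x => 'D_v f x).
Proof. by []. Qed.

Lemma Ck_eq W k U (f h : V -> W) : open U ->
  (forall x, U x -> f x = h x) -> Ck k U f -> Ck k U h.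
Proof.
move=> oU; elim: k f h => [|k IH] f h fh /=.
  move=> cf x Ux; have fhx : \near x, f x = h x.
    by apply: filterS (open_nbhs_nbhs (conj oU Ux)) => y /fh.
  rewrite /prop_for /continuous_at -(fh _ Ux).
  by apply: cvg_trans (cf x Ux); exact: near_eq_cvg.
have fhx x : U x -> \near x, f x = h x.
  by move=> Ux; apply: filterS (open_nbhs_nbhs (conj oU Ux)) => y /fh.
move=> [df Cf]; split=> [x Ux|v].
  by apply: near_eq_differentiable (df x Ux); exact: fhx.
by apply: IH (Cf v) => x Ux; apply: near_eq_derive; exact: fhx.
Qed.

Lemma Ck_subset W k U U' (f : V -> W) : U' `<=` U -> Ck k U f -> Ck k U' f.
Proof.
move=> UU'; elim: k f => [|k IH] f /=; first by move=> + x /UU'; apply.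
by move=> [df Cf]; split=> [x /UU'|v]; [exact: df|exact/IH/Cf].
Qed.

Lemma CkW W k U (f : V -> W) : Ck k.+1 U f -> Ck k U f.
Proof.
elim: k f => [|k IH] f [df Cf] /=.
  by move=> x Ux; exact/differentiable_continuous/df.
by split=> // v; exact/IH/Cf.
Qed.

Lemma Ck_cst W k U (w : W) : Ck k U (fun=> w).
Proof.
elim: k w => [|k IH] w /=; first by move=> x _; exact: cst_continuous.
split=> [x _|v]; first exact: differentiable_cst.
suff -> : (fun x => 'D_v (fun=> w) x) = fun=> (0 : W) by exact: IH.
by rewrite funeqE => x; exact: derive_cst.
Qed.

Lemma CkD W k U (f h : V -> W) : open U ->
  Ck k U f -> Ck k U h -> Ck k U (fun x => f x + h x).
Proof.
move=> oU; elim: k f h => [|k IH] f h /=.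
  by move=> cf ch x Ux; apply: continuousD; [exact: cf|exact: ch].
move=> [df Cf] [dh Ch]; split=> [x Ux|v].
  by apply: differentiableD; [exact: df|exact: dh].
apply: Ck_eq (IH _ _ (Cf v) (Ch v)) => // x Ux.
by rewrite -deriveD //; apply: diff_derivable; [exact: df|exact: dh].
Qed.

(** By induction on [k] through the Leibniz rule; [CkW] puts the factors that
    are not differentiated back into class C^k. *)
Lemma CkM k U (f h : V -> R) : open U ->
  Ck k U f -> Ck k U h -> Ck k U (fun x => f x * h x).
Proof.
move=> oU; elim: k f h => [|k IH] f h.
  by move=> /= cf ch x Ux; apply: continuousM; [exact: cf|exact: ch].
move=> Cf Ch; have [df Df] := (CkS _ _ _).1 Cf; have [dh Dh] := (CkS _ _ _).1 Ch.
apply/CkS; split=> [x Ux|v]; first by apply: differentiableM; [exact: df|exact: dh].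
apply: (Ck_eq oU _ (CkD oU (IH _ _ (CkW Cf) (Dh v)) (IH _ _ (CkW Ch) (Df v)))).
by move=> x Ux; rewrite -deriveM //; apply: diff_derivable; [exact: df|exact: dh].
Qed.

Lemma CkZl W k U (f : V -> R) (w : W) : open U ->
  Ck k U f -> Ck k U (fun x => f x *: w).
Proof.
move=> oU; elim: k f => [|k IH] f /=.
  move=> cf x Ux; apply: (@cvgZl _ _ _ _ _ _ _ _ (cf x Ux)).
move=> [df Cf]; split=> [x Ux|v].
  by apply: differentiableZl; exact: df.
apply: Ck_eq (IH _ (Cf v)) => // x Ux.
by rewrite !deriveE ?diffZl//; [exact: df|exact/differentiableZl/df|exact:df].
Qed.

(** By induction on [k], since the derivative of [1/f] is [- (1/f)^2 f'], where
    [1/f] is already known to be of class C^k. *)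
Lemma CkV k U (f : V -> R) : open U -> (forall x, U x -> f x != 0) ->
  Ck k U f -> Ck k U (fun x => (f x)^-1).
Proof.
move=> oU f0; elim: k => [|k IH].
  by move=> /= cf x Ux; apply: continuousV; [exact: f0|exact: cf].
move=> Cf; have [df Df] := (CkS _ _ _).1 Cf; have CV := IH (CkW Cf).
apply/CkS; split=> [x Ux|v]; first by apply: differentiableV; [exact: df|exact: f0].
have CN := CkM oU (Ck_cst k U (-1 : R)) (CkM oU CV CV).
apply: Ck_eq (CkM oU CN (Df v)) => // x Ux.
rewrite deriveV; [|exact: f0|exact/diff_derivable/df].
by rewrite expr2 invfM mulN1r.
Qed.

End Ck_calculus.

(** * Germs of smooth functions *)

Section smooth_near_calculus.
Context {R : realType} {V : normedModType R}.
Implicit Types (W : normedModType R) (x : V).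

Lemma smooth_near_eq W (f h : V -> W) x :
  (\forall y \near x, f y = h y) -> smooth_near f x -> smooth_near h x.
Proof.
rewrite -nbhs_nearE nbhsE => -[Q [oQ Qx] fh] [U [oU Ux Cf]].
exists (U `&` Q); split; [exact: openI|by []|move=> k].
apply: (@Ck_eq _ _ _ _ _ f); first exact: openI.
  by move=> y [_ /fh].
by apply: Ck_subset (Cf k) => y [].
Qed.

Lemma smooth_near_differentiable W (f : V -> W) x :
  smooth_near f x -> differentiable f x.
Proof. by move=> [U [_ Ux /(_ 1)[df _]]]; exact: df. Qed.

Lemma smooth_near_derive W (f : V -> W) v x :
  smooth_near f x -> smooth_near (fun y => 'D_v f y) x.
Proof.
move=> [U [oU Ux Cf]]; exists U; split => // k.
by have [_] := Cf k.+1; apply.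
Qed.

Lemma smooth_near_cst W (w : W) x : smooth_near (fun=> w) x.
Proof. by exists setT; split=> [|//|k]; [exact: openT|exact: Ck_cst]. Qed.

Lemma smooth_nearD W (f h : V -> W) x : smooth_near f x -> smooth_near h x ->
  smooth_near (fun y => f y + h y) x.
Proof.
move=> [U [oU Ux Cf]] [Q [oQ Qx Ch]].
exists (U `&` Q); split; [exact: openI|by []|move=> k].
apply: CkD; first exact: openI.
- by apply: Ck_subset (Cf k) => y [].
- by apply: Ck_subset (Ch k) => y [].
Qed.

Lemma smooth_nearM (f h : V -> R) x : smooth_near f x -> smooth_near h x ->
  smooth_near (fun y => f y * h y) x.
Proof.
move=> [U [oU Ux Cf]] [Q [oQ Qx Ch]].
exists (U `&` Q); split; [exact: openI|by []|move=> k].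
apply: CkM; first exact: openI.
- by apply: Ck_subset (Cf k) => y [].
- by apply: Ck_subset (Ch k) => y [].
Qed.

Lemma smooth_nearZl W (f : V -> R) (w : W) x : smooth_near f x ->
  smooth_near (fun y => f y *: w) x.
Proof. by move=> [U [oU Ux Cf]]; exists U; split => // k; exact: CkZl. Qed.

Lemma smooth_nearV (f : V -> R) x : f x != 0 -> smooth_near f x ->
  smooth_near (fun y => (f y)^-1) x.
Proof.
move=> fx0 sf; have := smooth_near_differentiable sf.
move=> /differentiable_continuous cf; have [U [oU Ux Cf]] := sf.
have : \forall y \near x, f y != 0.
  by apply: (cf [set y | y != 0]); apply: open_nbhs_nbhs; split => //; exact: open_neq.
rewrite -nbhs_nearE nbhsE => -[Q [oQ Qx] f0].
exists (U `&` Q); split; [exact: openI|by []|move=> k].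
apply: CkV; [exact: openI|by move=> y [_ /f0]|].
by apply: Ck_subset (Cf k) => y [].
Qed.

Lemma smooth_near_sum W (I : Type) (r : seq I) (P : pred I) (F : I -> V -> W) x :
  (forall i, P i -> smooth_near (F i) x) ->
  smooth_near (fun y => \sum_(i <- r | P i) F i y) x.
Proof.
move=> sF; elim: r => [|i r IH].
  apply: smooth_near_eq (smooth_near_cst (0 : W) x).
  by apply: nearW => y /=; rewrite big_nil.
suff : smooth_near (fun y => if P i then F i y + \sum_(j <- r | P j) F j y
             else \sum_(j <- r | P j) F j y) x.
  by move=> sFr; apply: smooth_near_eq sFr; apply: nearW => y; rewrite big_cons.
by case: (P i) (sF i) => [sFi|_ //]; apply: smooth_nearD => //; exact: sFi.
Qed.

Lemma smooth_near_prod (I : Type) (r : seq I) (P : pred I) (F : I -> V -> R) x :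
  (forall i, P i -> smooth_near (F i) x) ->
  smooth_near (fun y => \prod_(i <- r | P i) F i y) x.
Proof.
move=> sF; elim: r => [|i r IH].
  apply: smooth_near_eq (smooth_near_cst (1 : R) x).
  by apply: nearW => y /=; rewrite big_nil.
suff : smooth_near (fun y => if P i then F i y * \prod_(j <- r | P j) F j y
             else \prod_(j <- r | P j) F j y) x.
  by move=> sFr; apply: smooth_near_eq sFr; apply: nearW => y; rewrite big_cons.
by case: (P i) (sF i) => [sFi|_ //]; apply: smooth_nearM => //; exact: sFi.
Qed.

Lemma smooth_near_det n (A : V -> 'M[R]_n) x :
  (forall i j, smooth_near (fun y => A y i j) x) ->
  smooth_near (fun y => \det (A y)) x.
Proof.
move=> sA; rewrite /determinant; apply: smooth_near_sum => s _.
apply: smooth_nearM; first exact: smooth_near_cst.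
by apply: smooth_near_prod.
Qed.

(** Cramer's formula.  It is stated with the adjugate rather than [invmx],
    whose value on singular matrices is a convention. *)
Lemma smooth_near_invmx n (A : V -> 'M[R]_n) x i j :
  \det (A x) != 0 -> (forall i j, smooth_near (fun y => A y i j) x) ->
  smooth_near (fun y => ((\det (A y))^-1 *: \adj (A y)) i j) x.
Proof.
move=> dA sA.
apply: (@smooth_near_eq _ (fun y => (\det (A y))^-1 * \adj (A y) i j)).
  by apply: nearW => y; rewrite [RHS]mxE.
apply: smooth_nearM; first by apply: smooth_nearV => //; exact: smooth_near_det.
apply: (@smooth_near_eq _ (fun y => cofactor (A y) j i)).
  by apply: nearW => y; rewrite [RHS]mxE.
apply: smooth_nearM; first exact: smooth_near_cst.
apply: smooth_near_det => k l.
by apply: smooth_near_eq (sA _ _); apply: nearW => y; rewrite !mxE.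
Qed.

Lemma smooth_near_row n (f : V -> 'rV[R]_n) x :
  (forall j, smooth_near (fun y => f y 0 j) x) -> smooth_near f x.
Proof.
move=> sf; have -> : f = fun y => \sum_j f y 0 j *: delta_mx 0 j.
  by rewrite funeqE => y; rewrite -row_sum_delta.
by apply: smooth_near_sum => j _; exact: smooth_nearZl.
Qed.

End smooth_near_calculus.

(** * Changes of charts and coordinate fields *)

Lemma derive_linear (R : numFieldType) (V W : normedModType R) (f : V -> W) x :
  differentiable f x -> linear (fun v => 'D_v f x).
Proof. by move=> df a u v; rewrite !deriveE// linearP. Qed.

Section charts.
Context {R : realType} {n : nat} {M : manifold R n}.
Implicit Types (phi psi : chart R M n) (p q : M).

(** Points near [chart_map phi q] are images of points near [q], since the image
    of [phi] is open and [chart_inv phi] is continuous there; so [chart_inv phi] is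
    a two-sided inverse on a neighbourhood. *)
Lemma near_chart phi q (A : set M) : chart_dom phi q -> nbhs q A ->
  \forall x \near chart_map phi q, [/\ chart_dom phi (chart_inv phi x),
    A (chart_inv phi x) & chart_map phi (chart_inv phi x) = x].
Proof.
move=> dq qA.
have img : \forall x \near chart_map phi q, (chart_map phi @` chart_dom phi) x.
  by apply: open_nbhs_nbhs; split; [exact: chart_img_open|exists q].
have inA : \forall x \near chart_map phi q, A (chart_inv phi x).
  by apply: (chart_inv_continuous dq); rewrite chart_mapK.
near=> x; have [r dr rx] : (chart_map phi @` chart_dom phi) x by near: x.
by split; [rewrite -rx chart_mapK| near: x|rewrite -rx chart_mapK].
Unshelve. all: by end_near. Qed.

Lemma chart_dom_nbhs phi q : chart_dom phi q -> nbhs q (chart_dom phi).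
Proof.
by move=> dq; apply: open_nbhs_nbhs; split=> //; exact: chart_dom_open.
Qed.

Lemma transition_differentiable phi psi q : atlas phi -> atlas psi ->
  chart_dom phi q -> chart_dom psi q ->
  differentiable (chart_map psi \o chart_inv phi) (chart_map phi q).
Proof.
move=> aphi apsi qphi qpsi.
by have [+ _] := atlas_compatible aphi apsi 1; apply; exists q.
Qed.

Section change_of_chart.
Variables (phi psi : chart R M n) (q : M).
Hypotheses (aphi : atlas phi) (apsi : atlas psi).
Hypotheses (qphi : chart_dom phi q) (qpsi : chart_dom psi q).

Section with_function.
Variables (W : normedModType R) (h : M -> W).
Hypothesis dh : differentiable (h \o chart_inv psi) (chart_map psi q).

Let transitionE : \forall x \near chart_map phi q,
  (h \o chart_inv psi) ((chart_map psi \o chart_inv phi) x) =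
  (h \o chart_inv phi) x.
Proof.
apply: filterS (near_chart qphi (chart_dom_nbhs qpsi)) => x [_ xpsi _] /=.
by rewrite chart_mapK.
Qed.

Let dh_psi :
  differentiable (h \o chart_inv psi)
    ((chart_map psi \o chart_inv phi) (chart_map phi q)).
Proof. by rewrite /= chart_mapK. Qed.

Lemma differentiable_change_chart :
  differentiable (h \o chart_inv phi) (chart_map phi q).
Proof.
apply: near_eq_differentiable transitionE _.
by apply: differentiable_comp => //; exact: transition_differentiable.
Qed.

(** The chain rule for [h \o chart_inv phi], which near [chart_map phi q] factors
    through the transition map to [psi]. *)
Lemma derive_change_chart (v : 'rV[R]_n) :
  'D_v (h \o chart_inv phi) (chart_map phi q) =
  'D_('D_v (chart_map psi \o chart_inv phi) (chart_map phi q))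
    (h \o chart_inv psi) (chart_map psi q).
Proof.
have dt := transition_differentiable aphi apsi qphi qpsi.
transitivity ('D_v ((h \o chart_inv psi) \o (chart_map psi \o chart_inv phi))
                (chart_map phi q)).
  by apply/esym/near_eq_derive; exact: transitionE.
rewrite deriveE; last exact: differentiable_comp.
by rewrite diff_comp //= [in RHS]deriveE // (deriveE _ dt) chart_mapK.
Qed.

End with_function.
End change_of_chart.

Lemma derive_chart_id phi q (v : 'rV[R]_n) : chart_dom phi q ->
  'D_v (chart_map phi \o chart_inv phi) (chart_map phi q) = v.
Proof.
move=> dq; transitivity ('D_v (@id 'rV[R]_n) (chart_map phi q)); last first.
  exact: derive_id.
apply: near_eq_derive; apply: filterS (near_chart dq (chart_dom_nbhs dq)).
by move=> x [].
Qed.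

Section frame.
Variables (phi : chart R M n) (q : M).
Hypotheses (aphi : atlas phi) (qphi : chart_dom phi q).

Lemma components_linear : linear (@components R n M phi q).
Proof.
apply: derive_linear.
exact: transition_differentiable (chart_at_atlas _) aphi (chart_at_dom _) qphi.
Qed.

(** [components phi] and [chart_basis phi] are given by the differentials of
    mutually inverse transition maps, so the chain rule reduces both this lemma
    and [sum_components] to the derivative of the identity. *)
Lemma components_chart_basis j :
  components phi (chart_basis phi j q) = delta_mx 0 j.
Proof.
have aq := chart_at_atlas q; have dq := chart_at_dom q.
rewrite /components /chart_basis -derive_change_chart// ?derive_chart_id//.
exact: transition_differentiable.
Qed.

(** The coordinate fields of an arbitrary chart span the tangent space, whatever
    the preferred chart at [q]: this is what makes vectors at distinct points
    comparable. *)
Lemma sum_components (v : tangent q) :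
  v = \sum_j components phi v 0 j *: chart_basis phi j q.
Proof.
have aq := chart_at_atlas q; have dq := chart_at_dom q.
have dt := transition_differentiable aphi aq qphi dq.
rewrite -[LHS](derive_chart_id v dq).
rewrite (derive_change_chart aq aphi dq qphi dt).
rewrite -/(components phi v) deriveE// {1}[components phi v]row_sum_delta.
by rewrite linear_sum; apply: eq_bigr => j _; rewrite linearZ -deriveE.
Qed.

Lemma vderive_chart_basis (f : M -> R) j : fun_smooth_at f q ->
  vderive (chart_basis phi j q) f =
  'D_(delta_mx 0 j) (f \o chart_inv phi) (chart_map phi q).
Proof.
move=> sf; have df := smooth_near_differentiable sf.
rewrite (derive_change_chart aphi (chart_at_atlas q) qphi (chart_at_dom q))//.
Qed.

End frame.

Lemma vderive_linear (f : M -> R) q : fun_smooth_at f q ->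
  linear (fun v : tangent q => vderive v f : R).
Proof. by move=> sf; apply/derive_linear/smooth_near_differentiable. Qed.

End charts.

(** * Smoothness of the gradient *)

Section metric_algebra.
Context {R : realType} {n : nat} {M : manifold R n}.
Variables (g : pseudo_metric M) (p : M).
Implicit Types u v w : tangent p.

Lemma metricDl u v w : g p (u + v) w = g p u w + g p v w.
Proof. by have := metric_linear g 1 u v w; rewrite scale1r mul1r. Qed.

Lemma metric0l w : g p 0 w = 0.
Proof.
by apply: (@addrI _ (g p 0 w)); rewrite -metricDl !addr0.
Qed.

Lemma metricZl a u w : g p (a *: u) w = a * g p u w.
Proof. by have := metric_linear g a u 0 w; rewrite metric0l !addr0. Qed.

Lemma metricBl u v w : g p (u - v) w = g p u w - g p v w.
Proof. by rewrite -scaleN1r metricDl metricZl mulN1r. Qed.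

Lemma metric_sum (I : finType) (u : I -> tangent p) w :
  g p (\sum_i u i) w = \sum_i g p (u i) w.
Proof.
exact: (big_morph (fun u => g p u w) (fun u v => metricDl u v w) (metric0l w)).
Qed.

Lemma metric_suml (I : finType) (c : I -> R) (u : I -> tangent p) w :
  g p (\sum_i c i *: u i) w = \sum_i c i * g p (u i) w.
Proof. by rewrite metric_sum; apply: eq_bigr => i _; exact: metricZl. Qed.

Lemma metric_sumr (I : finType) (c : I -> R) (u : I -> tangent p) w :
  g p w (\sum_i c i *: u i) = \sum_i c i * g p w (u i).
Proof.
by rewrite Defs.metric_sym metric_suml; apply: eq_bigr => i _; rewrite Defs.metric_sym.
Qed.

End metric_algebra.

Section gradient.
Context {R : realType} {n : nat} {M : manifold R n}.
Variable (g : pseudo_metric M).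
Implicit Types (phi : chart R M n) (p q : M) (f : M -> R).

Definition gram phi q : 'M[R]_n :=
  \matrix_(i, j) g q (chart_basis phi i q) (chart_basis phi j q).

Lemma components_sum phi q (c : 'I_n -> R) : atlas phi -> chart_dom phi q ->
  components phi (\sum_j c j *: chart_basis phi j q : tangent q) =
  \row_j c j.
Proof.
move=> aphi qphi; pose L := GRing.isLinear.Build _ _ _ _ _ (components_linear aphi qphi).
pose cL : {linear 'rV[R]_n -> 'rV[R]_n} := HB.pack (@components R n M phi q) L.
rewrite -[LHS]/(cL _) linear_sum [RHS]row_sum_delta.
apply: eq_bigr => j _; rewrite linearZ [X in _ = X *: _]mxE; congr (_ *: _).
exact: components_chart_basis.
Qed.

(** A row in the kernel of the Gram matrix is the coordinate row of a vector
    orthogonal to all coordinate fields, hence to everything. *)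
Lemma gram_unit phi q : atlas phi -> chart_dom phi q -> gram phi q \in unitmx.
Proof.
move=> aphi qphi; rewrite -row_free_unit -kermx_eq0; apply/eqP/row_matrixP => k.
rewrite row0.
have: row k (kermx (gram phi q)) *m gram phi q = 0.
  by apply/sub_kermxP; exact: row_sub.
move: (row k _) => u uG.
pose w : tangent q := \sum_i u 0 i *: chart_basis phi i q.
have w0 : w = 0.
  apply: (@metric_nondegenerate _ _ _ g q) => v.
  rewrite (sum_components aphi qphi v) metric_sumr big1 // => j _.
  rewrite metric_suml (_ : \sum_i _ = (u *m gram phi q) 0 j).
    by rewrite uG mxE mulr0.
  by rewrite mxE; apply: eq_bigr => i _; rewrite mxE.
have := components_sum (fun i => u 0 i) aphi qphi; rewrite -/w w0.
have lin := components_linear aphi qphi.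
have -> : components phi (0 : tangent q) = 0.
  by have := lin (-1) 0 0; rewrite scaleN1r addNr scaleN1r addNr.
by move=> /rowP u0; apply/rowP => i; have := u0 i; rewrite !mxE.
Qed.

Definition partials phi q f : 'rV[R]_n :=
  \row_j 'D_(delta_mx 0 j) (f \o chart_inv phi) (chart_map phi q).

(** Solving [g w (d/dx^j) = df/dx^j] for the components of [w] produces a vector
    that represents the differential of [f]; the gradient is this vector because
    the metric is nondegenerate. *)
Lemma components_gradient phi q f : atlas phi -> chart_dom phi q ->
  fun_smooth_at f q ->
  components phi (gradient g f q) = partials phi q f *m invmx (gram phi q).
Proof.
move=> aphi qphi sf; set c := _ *m _.
pose w : tangent q := \sum_i c 0 i *: chart_basis phi i q.
have gw (v : tangent q) : g q w v = vderive v f.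
  rewrite (sum_components aphi qphi v) metric_sumr.
  pose L := GRing.isLinear.Build _ _ _ _ _ (vderive_linear sf).
  pose vL : {linear 'rV[R]_n -> R} := HB.pack (fun v : tangent q => vderive v f) L.
  rewrite -[RHS]/(vL _) linear_sum; apply: eq_bigr => j _.
  rewrite linearZ /=; congr (_ * _).
  rewrite vderive_chart_basis// metric_suml.
  transitivity ((c *m gram phi q) 0 j).
    by rewrite mxE; apply: eq_bigr => i _; rewrite !mxE.
  by rewrite mulmxKV ?gram_unit// mxE.
have gradE : gradient g f q = w.
  have gP : forall v : tangent q, g q (gradient g f q) v = vderive v f.
    by rewrite /gradient; case: xgetP => [x -> //|/(_ w)]; case.
  apply/eqP; rewrite -subr_eq0; apply/eqP.
  by apply: (@metric_nondegenerate _ _ _ g q) => v; rewrite metricBl gP gw subrr.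
rewrite gradE components_sum//.
by apply/rowP => i; rewrite mxE.
Qed.

Lemma chart_basis_smooth p j : vfield_smooth_at (chart_basis (chart_at p) j) p.
Proof.
apply: smooth_near_eq (smooth_near_cst (delta_mx 0 j : 'rV[R]_n) _).
have dp := chart_at_dom p.
apply: filterS (near_chart dp (chart_dom_nbhs dp)) => x [xp _ _].
by rewrite components_chart_basis//; exact: chart_at_atlas.
Qed.

(** Since the metric is smooth on coordinate fields, all entries of the formula
    in [components_gradient] are smooth in the chart at [p]. *)
Lemma gradient_smooth p f : (forall q, fun_smooth_at f q) ->
  vfield_smooth_at (gradient g f) p.
Proof.
move=> sf; have ap := chart_at_atlas p; have dp := chart_at_dom p.
set phi := chart_at p in ap dp *; set x := chart_map phi p.
have sG i j : smooth_near (fun y => gram phi (chart_inv phi y) i j) x.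
  have sg := metric_smooth g (chart_basis_smooth p i) (chart_basis_smooth p j).
  suff -> : (fun y => gram phi (chart_inv phi y) i j) =
      (fun q => g q (chart_basis phi i q) (chart_basis phi j q)) \o chart_inv phi.
    exact: sg.
  by rewrite funeqE => y; rewrite mxE.
pose b y k := 'D_(delta_mx 0 k) (f \o chart_inv phi) y.
pose iG y := (\det (gram phi (chart_inv phi y)))^-1 *: \adj (gram phi (chart_inv phi y)).
apply: smooth_near_row => j.
have sb : smooth_near (fun y => \sum_k b y k * iG y k j) x.
  apply: smooth_near_sum => k _; apply: smooth_nearM.
    exact: smooth_near_derive (sf p).
  apply: smooth_near_invmx => //.
  by rewrite -unitfE -unitmxE; apply: gram_unit => //; rewrite chart_mapK.
apply: smooth_near_eq sb.
apply: filterS (near_chart dp (chart_dom_nbhs dp)) => y [yd _ yE].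
rewrite components_gradient// mxE; apply: eq_bigr => k _.
by rewrite [partials _ _ _ 0 k]mxE yE /invmx gram_unit.
Qed.

End gradient.

(** * Differentiation along a curve *)

Section along_curve.
Context {R : realType} {n : nat} {M : manifold R n}.
Variables (g : pseudo_metric M) (D : connection M).
Variables (alpha : R -> M) (s : R).
Hypothesis alpha_continuous : {for s, continuous alpha}.
Hypothesis alpha_smooth :
  smooth_near (chart_map (chart_at (alpha s)) \o alpha : R^o -> 'rV[R]_n) s.

Let phi := chart_at (alpha s).
Let aphi : atlas phi. Proof. exact: chart_at_atlas. Qed.
Let dphi : chart_dom phi (alpha s). Proof. exact: chart_at_dom. Qed.

Let near_dom : \forall t \near s, chart_dom phi (alpha t).
Proof. exact: (alpha_continuous (chart_dom_nbhs dphi)). Qed.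

Lemma is_derive_along (h : M -> R) : fun_smooth_at h (alpha s) ->
  is_derive s 1 (h \o alpha) (vderive (velocity alpha s) h).
Proof.
move=> sh; have dh := smooth_near_differentiable sh.
have da := smooth_near_differentiable alpha_smooth.
apply: (near_eq_is_derive (f := (h \o chart_inv phi) \o (chart_map phi \o alpha))).
  by apply: filterS near_dom => t dt /=; rewrite chart_mapK.
have dc : differentiable ((h \o chart_inv phi) \o (chart_map phi \o alpha)) s.
  exact: differentiable_comp.
apply: DeriveDef; first exact: diff_derivable.
rewrite deriveE// diff_comp//= /vderive /velocity derive1E.
by rewrite [in RHS]deriveE// (deriveE _ da).
Qed.

Hypotheses (compat : metric_compatible g D).

(** Near [s], [g W V] is the sum of the [a j] times the functions [h j] evaluated
    along the curve, where [a j] are the components of [V] in the chart at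
    [alpha s] and [h j] is the product of [W] with the coordinate field.  The
    derivative of [h j] comes from metric compatibility on the manifold, and the
    terms with [a j] and its derivative regroup into [cov_along D V]. *)
Lemma is_derive_metric_along (W : vfield M) (V : vfield_along alpha) :
  vfield_smooth_at W (alpha s) ->
  smooth_near ((fun t => components phi (V t)) : R^o -> 'rV[R]_n) s ->
  is_derive s 1 (fun t => g (alpha t) (W (alpha t)) (V t))
    (g (alpha s) (D (alpha s) (velocity alpha s) W) (V s) +
     g (alpha s) (W (alpha s)) (cov_along D V s)).
Proof.
move=> sW sV.
pose a j (t : R) : R := components phi (V t) 0 j.
pose h j q := g q (W q) (chart_basis phi j q).
have da j : is_derive s 1 (a j) (derive1 (a j) s).
  rewrite derive1E; apply: derivableP; apply: diff_derivable.
  have dV := smooth_near_differentiable sV.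
  exact: differentiable_comp dV (differentiable_coord _ _ _).
have dh j : is_derive s 1 (h j \o alpha)
    (g (alpha s) (D (alpha s) (velocity alpha s) W) (chart_basis phi j (alpha s)) +
     g (alpha s) (W (alpha s)) (D (alpha s) (velocity alpha s) (chart_basis phi j))).
  have sE := chart_basis_smooth (alpha s) j.
  have gE := compat (velocity alpha s) sW sE.
  exact: (is_derive_eq (is_derive_along (metric_smooth g sW sE)) gE).
apply: (near_eq_is_derive (f := \sum_j (a j * (h j \o alpha)))).
  apply: filterS near_dom => t dt; rewrite fct_sumE.
  rewrite [in RHS](sum_components aphi dt (V t)) metric_sumr.
  by apply: eq_bigr.
apply: is_derive_eq.
rewrite [in RHS](sum_components aphi dphi (V s)) metric_sumr.
rewrite /cov_along -/phi [X in _ = _ + X]Defs.metric_sym metric_sum.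
rewrite -!big_split; apply: eq_bigr => j _ /=; rewrite metricDl !metricZl.
rewrite (Defs.metric_sym g (chart_basis phi j (alpha s)) (W (alpha s))).
rewrite (Defs.metric_sym g _ (W (alpha s))) -/(h j (alpha s)) -/(a j) -/(a j s).
rewrite [X in _ = _ + X]addrC addrA -mulrDr [X in _ = _ + X]mulrC.
by [].
Qed.
End along_curve.

(** * Constant functions on intervals *)

Section real_intervals.
Context {R : realType}.
Variables (I : set R) (F : R -> R).

Lemma is_derive_cst_on (c d s : R) : open I -> I s ->
  (forall t, I t -> F t = c) -> is_derive s 1 F d -> d = 0.
Proof.
move=> oI Is Fc dF; rewrite -[LHS](@derive_val _ _ _ _ _ _ _ dF).
rewrite -(derive_cst c s 1); apply: near_eq_derive.
by apply: filterS (open_nbhs_nbhs (conj oI Is)) => t /Fc.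
Qed.

Lemma is_derive0_cst : is_interval I ->
  (forall s, I s -> is_derive s 1 F 0) -> forall s t, I s -> I t -> F s = F t.
Proof.
move=> itvI dF s t; wlog st : s t / s <= t => [H Is It|Is It].
  by have /orP[/H|/H] := le_total s t => [->|<-].
have sub x : x \in `[s, t]%R -> I x.
  by rewrite in_itv /= => xst; exact: itvI Is It _ xst.
have dst x : x \in `]s, t[%R -> is_derive x 1 F 0.
  by move=> xst; apply/dF/sub; exact: subset_itv_oo_cc.
have cst : {within `[s, t], continuous F}.
  by apply: derivable_within_continuous => x /sub/dF[].
have [x _] := MVT_segment st dst cst.
by rewrite mul0r => /eqP; rewrite subr_eq0 => /eqP.
Qed.

End real_intervals.

(** * Vectors orthogonal to a frame *)

Section orthogonality.
Context {R : realType} {n : nat} {M : manifold R n}.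
Variables (g : pseudo_metric M) (p : M).

(** The hypothesis says that the Gram matrix of [E] has trivial kernel.  This
    makes the matrix of the [E i] invertible, so the [n] vectors span and
    nondegeneracy applies. *)
Lemma orthogonal_frame_eq0 (E : 'I_n -> tangent p) :
  (forall c : 'I_n -> R, (forall j, g p (\sum_i c i *: E i) (E j) = 0) ->
    forall i, c i = 0) ->
  forall d : tangent p, (forall i, g p d (E i) = 0) -> d = 0.
Proof.
move=> Eindep d dE; pose B : 'M[R]_n := \matrix_i E i.
have BE (u : 'rV[R]_n) : u *m B = \sum_i u 0 i *: E i.
  by rewrite mulmx_sum_row; apply: eq_bigr => i _; rewrite rowK.
have Bunit : B \in unitmx.
  rewrite -row_free_unit -kermx_eq0; apply/eqP/row_matrixP => k; rewrite row0.
  have: row k (kermx B) *m B = 0 by apply/sub_kermxP; exact: row_sub.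
  move: (row k _) => u uB; apply/rowP => i; rewrite mxE.
  by apply: (Eindep (fun i => u 0 i)) => j; rewrite -BE uB metric0l.
apply: (@metric_nondegenerate _ _ _ g p) => v.
rewrite -[v](mulmxKV Bunit) BE metric_sumr big1// => i _.
by rewrite dE mulr0.
Qed.

End orthogonality.

(** Pairing a combination of the frame with [V2], [V1] and [V3] reads off its
    coefficients along [V1], [V2] and [V3]. *)
Lemma orthogonal_null_frame_eq0 (R : realType) (M : manifold R 3)
    (g : pseudo_metric M) (p : M) (V1 V2 V3 d : tangent p) :
  g p V1 V1 = 0 -> g p V2 V2 = 0 -> g p V1 V2 = 1 ->
  g p V1 V3 = 0 -> g p V2 V3 = 0 -> g p V3 V3 = 1 ->
  g p d V1 = 0 -> g p d V2 = 0 -> g p d V3 = 0 -> d = 0.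
Proof.
move=> g11 g22 g12 g13 g23 g33 d1 d2 d3.
have g21 : g p V2 V1 = 1 by rewrite Defs.metric_sym.
have g31 : g p V3 V1 = 0 by rewrite Defs.metric_sym.
have g32 : g p V3 V2 = 0 by rewrite Defs.metric_sym.
pose E (i : 'I_3) : tangent p := tnth [tuple V1; V2; V3] i.
apply: (@orthogonal_frame_eq0 _ _ _ g p E) => [k kE|]; last first.
  by case=> [[|[|[|//]]]] /=.
have kv v : g p (\sum_i k i *: E i) v =
    k 0 * g p V1 v + (k 1 * g p V2 v + k 2%:R * g p V3 v).
  rewrite metric_suml !big_ord_recl big_ord0 addr0.
  by do ![congr (_ + _); last congr (_ + _)]; congr (k _ * _); exact: val_inj.
have k1 : k 0 = 0.
  by have := kE 1; rewrite kv /E /= g12 g22 g32 mulr1 !mulr0 !addr0.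
have k2 : k 1 = 0.
  by have := kE 0; rewrite kv /E /= g11 g21 g31 mulr1 !mulr0 add0r addr0.
have k3 : k 2%:R = 0.
  by have := kE 2%:R; rewrite kv /E /= g13 g23 g33 mulr1 !mulr0 !add0r.
case=> [[|[|[|//]]]] i3.
- by rewrite -k1; congr k; exact: val_inj.
- by rewrite -k2; congr k; exact: val_inj.
- by rewrite -k3; congr k; exact: val_inj.
Qed.

(** * Null helices *)

Lemma hessian0_parallel_gradient (R : realType) (n : nat) (M : manifold R n)
    (g : pseudo_metric M) (D : connection M) (f : M -> R) :
  (forall (p : M) (u v : tangent p), hessian g D f u v = 0) ->
  forall (p : M) (u : tangent p), D p u (gradient g f) = 0.
Proof.
move=> H p u; apply: (@metric_nondegenerate _ _ _ g p) => v; exact: H.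
Qed.

Theorem theorem3p1 (R : realType) (M : manifold R 3) (g : pseudo_metric M)
    (lorentz_g : lorentzian g)
    (D : connection M) (levi_civita_D : levi_civita g D)
    (I : set R) (open_I : open I) (interval_I : is_interval I)
    (alpha : R -> M) (null_alpha : null_curve g I alpha)
    (V1 V2 V3 : vfield_along alpha) (kappa tau : R -> R)
    (frame : cartan_frame g D I V1 V2 V3 kappa tau)
    (kappa_neq0 : forall s, I s -> kappa s != 0)
    (tau_neq0 : forall s, I s -> tau s != 0)
    (f : M -> R) (smooth_f : forall p, fun_smooth_at f p)
    (eikonal_f : eikonal_along g I alpha f)
    (hessian_f : forall (p : M) (u v : tangent p), hessian g D f u v = 0)
    (helix_alpha : null_eikonal_helix g I alpha f) :
  (exists k : R, forall s, I s -> kappa s / tau s = k) /\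
  (exists2 c : R, c != 0 & forall s, I s ->
     g (alpha s) (gradient g f (alpha s)) (V1 s) = c /\
     gradient g f (alpha s) = c *: ((- tau s / kappa s) *: V1 s + V2 s)).
Proof.
have [_ _ [c c0 Wc]] := helix_alpha.
have [_ compat] := levi_civita_D; have [smooth_alpha _] := null_alpha.
pose W s := gradient g f (alpha s).
have dW (V : vfield_along alpha) s : smooth_along I V -> I s ->
    is_derive s 1 (fun t => g (alpha t) (W t) (V t))
      (g (alpha s) (W s) (cov_along D V s)).
  move=> sV Is; have [ca sa] := smooth_alpha s Is.
  have := is_derive_metric_along ca sa compat (gradient_smooth g _ smooth_f) (sV s Is).
  by rewrite (hessian0_parallel_gradient hessian_f) metric0l add0r.
(* [W1], [W2] and [W3] are the products of the gradient with the frame. *)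
have W1 s : I s -> g (alpha s) (W s) (V1 s) = c.
  by move=> Is; rewrite (frame_tangent frame Is) Wc.
have W3 s : I s -> g (alpha s) (W s) (V3 s) = 0.
  move=> Is; apply: (@mulfI _ (kappa s)); [exact: kappa_neq0|rewrite mulr0].
  have := is_derive_cst_on open_I Is W1 (dW _ _ (frame_smooth1 frame) Is).
  by rewrite (frame_cov1 frame Is) Defs.metric_sym metricZl Defs.metric_sym.
have W2 s : I s -> g (alpha s) (W s) (V2 s) = - tau s / kappa s * c.
  move=> Is; apply: (@mulfI _ (kappa s)); first exact: kappa_neq0.
  have := is_derive_cst_on open_I Is W3 (dW _ _ (frame_smooth3 frame) Is).
  rewrite (frame_cov3 frame Is) Defs.metric_sym metricBl !metricZl.
  rewrite ![g (alpha s) _ (W s)]Defs.metric_sym (W1 s Is) => /eqP.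
  rewrite subr_eq0 => /eqP <-.
  by rewrite mulrA mulrCA mulfV ?mulr1 ?kappa_neq0.
have W2_cst s t : I s -> I t ->
    g (alpha s) (W s) (V2 s) = g (alpha t) (W t) (V2 t).
  pose F t := g (alpha t) (W t) (V2 t).
  apply: (@is_derive0_cst _ I F) => // u Iu; rewrite /F.
  have := dW _ _ (frame_smooth2 frame) Iu.
  rewrite (frame_cov2 frame Iu) [X in is_derive _ _ _ X]Defs.metric_sym.
  by rewrite metricZl Defs.metric_sym W3// mulr0.
split.
  have [I0|/set0P[s0 Is0]] := eqVneq I set0.
    by exists 0 => s; rewrite I0.
  (* Compare the opposite inverses, which are the values of [g W V2] over [c]. *)
  exists (kappa s0 / tau s0) => s Is; apply/invr_inj/oppr_inj.
  rewrite !invfM !invrK ![_^-1 * _]mulrC -!mulNr.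
  by apply: (mulIf c0); rewrite -W2// -W2//; exact: W2_cst.
exists c => // s Is; split; first exact: W1.
have [[g11 g22] g12] := (frame_g11 frame Is, frame_g22 frame Is, frame_g12 frame Is).
have [[g13 g23] g33] := (frame_g13 frame Is, frame_g23 frame Is, frame_g33 frame Is).
have g21 : g (alpha s) (V2 s) (V1 s) = 1 by rewrite Defs.metric_sym.
have orth := @orthogonal_null_frame_eq0 _ _ g (alpha s) (V1 s) (V2 s) (V3 s).
apply/eqP; rewrite -subr_eq0; apply/eqP; rewrite -/(W s).
apply: orth => //.
- by rewrite metricBl metricZl metricDl metricZl g11 g21 W1// mulr0 add0r mulr1 subrr.
- rewrite metricBl metricZl metricDl metricZl g12 g22 W2//.
  by rewrite mulr1 addr0 mulrC subrr.
- by rewrite metricBl metricZl metricDl metricZl g13 g23 W3// mulr0 addr0 mulr0 subrr.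
Qed.
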